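(* Let $P\subset\mathbb{R}^2$ be a convex body. If a basis $(h^1,h^2)$ of $\mathbb{Z}^2$ is reduced with respect to $P$, then $\operatorname{ls}_\Delta(P)=\operatorname{nls}_\Delta(AP)$, where $A$ is the matrix whose rows are $h^1$ and $h^2$.
   Context: A convex body is a compact convex set with nonempty interior. For $h\in\mathbb{R}^2$, the lattice width of $P$ in the direction $h$ is $\operatorname{w}_h(P)=\max_{x\in P}h\cdot x-\min_{x\in P}h\cdot x$ (standard dot product). A basis $(h^1,h^2)$ of the integer lattice $\mathbb{Z}^2$ is reduced with respect to $P$ (equivalently, with respect to $K=(P+(-P))^\circ$, the polar dual of the Minkowski sum of $P$ and $-P$, whose norm satisfies $\Vert h\Vert_K=\operatorname{w}_h(P)$) if $\operatorname{w}_{h^i}(P)\le\operatorname{w}_{h^1\pm h^2}(P)$ for $i=1,2$ (both signs). No ordering of $\operatorname{w}_{h^1}(P)$ and $\operatorname{w}_{h^2}(P)$ is required. $\Delta=\operatorname{conv}\{0,e^1,e^2\}\subset\mathbb{R}^2$ is the standard simplex, $l\Delta$ is its $l$-dilate, and $\mathrm{GL}(2,\mathbb{Z})$ is the group of integer $2\times 2$ matrices with determinant $\pm1$. For a $2\times 2$ matrix $A$, $AP=\{Ax\mid x\in P\}$. The lattice size $\operatorname{ls}_\Delta(P)$ is the smallest real $l\ge 0$ such that $BP+v\subset l\Delta$ for some $B\in\mathrm{GL}(2,\mathbb{Z})$ and some $v\in\mathbb{R}^2$. For a convex body $Q\subset\mathbb{R}^2$, the naive lattice size $\operatorname{nls}_\Delta(Q)$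 is the smallest real $l\ge0$ such that $DQ+v\subset l\Delta$ for some diagonal matrix $D$ with diagonal entries $\pm1$ and some $v\in\mathbb{R}^2$. Equivalently, $\operatorname{nls}_\Delta(Q)=\min\{l_1(Q),l_2(Q),l_3(Q),l_4(Q)\}$, where (all maxima and minima over $(x,y)\in Q$) $l_1(Q)=\max(x+y)-\min x-\min y$, $l_2(Q)=\max x+\max y-\min(x+y)$, $l_3(Q)=\max y-\min x+\max(x-y)$, $l_4(Q)=\max x-\min y+\max(y-x)$. *)

(* Defs.v *)
From HB Require Import structures.
From mathcomp Require Import all_boot all_order all_algebra.
From mathcomp Require Import all_classical all_reals all_analysis.
From mathcomp Require Import lra zify.

Set Implicit Arguments.
Unset Strict Implicit.
Unset Printing Implicit Defensive.

Import Order.TTheory GRing.Theory Num.Theory.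
Import numFieldNormedType.Exports.

Local Open Scope classical_set_scope.
Local Open Scope ring_scope.

(* Points of the plane are columns and directions h are rows, so h *m x is the
   standard dot product and a matrix A acts by x |-> A *m x. *)

Definition convex_body (R : realType) (P : set 'cV[R]_2) : Prop :=
  [/\ compact P, convex_set P & P° !=set0].

(* On a compact P the supremum and infimum are the maximum and minimum. *)
Definition lattice_width (R : realType) (P : set 'cV[R]_2) (h : 'rV[R]_2) : R :=
  sup [set (h *m x) 0 0 | x in P] - inf [set (h *m x) 0 0 | x in P].

Definition lattice_basis (h1 h2 : 'rV[int]_2) : Prop :=
  forall z : 'rV[int]_2,
    exists! c : int * int, z = c.1 *: h1 + c.2 *: h2.

Definition reduced_basis (R : realType) (P : set 'cV[R]_2)
    (h1 h2 : 'rV[int]_2) : Prop :=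
  let w (h : 'rV[int]_2) := lattice_width P (map_mx intr h) in
  lattice_basis h1 h2 /\
  [/\ w h1 <= w (h1 + h2), w h1 <= w (h1 - h2),
      w h2 <= w (h1 + h2) & w h2 <= w (h1 - h2)].

Definition mx_image (R : realType) (A : 'M[R]_2) (P : set 'cV[R]_2) :
  set 'cV[R]_2 := [set A *m x | x in P].

Definition translate (R : realType) (v : 'cV[R]_2) (P : set 'cV[R]_2) :
  set 'cV[R]_2 := [set x + v | x in P].

Definition dilate (R : realType) (l : R) (P : set 'cV[R]_2) :
  set 'cV[R]_2 := [set l *: x | x in P].

Definition convex_hull (R : realType) (S : set 'cV[R]_2) : set 'cV[R]_2 :=
  smallest (fun C : set 'cV[R]_2 => convex_set C) S.

Definition std_simplex (R : realType) : set 'cV[R]_2 :=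
  convex_hull [set 0; delta_mx 0 0; delta_mx 1 0].

Definition GL2Z (B : 'M[int]_2) : Prop := \det B = 1 \/ \det B = -1.

Definition sign_diag (R : realType) (D : 'M[R]_2) : Prop :=
  is_diag_mx D /\ forall i, D i i = 1 \/ D i i = -1.

Definition lattice_size_set (R : realType) (P : set 'cV[R]_2) : set R :=
  [set l | 0 <= l /\ exists (B : 'M[int]_2) (v : 'cV[R]_2), GL2Z B /\
    translate v (mx_image (map_mx intr B) P) `<=` dilate l (@std_simplex R)].

Definition naive_lattice_size_set (R : realType) (Q : set 'cV[R]_2) : set R :=
  [set l | 0 <= l /\ exists (D : 'M[R]_2) (v : 'cV[R]_2), sign_diag D /\
    translate v (mx_image D Q) `<=` dilate l (@std_simplex R)].

(* These infima are minima, see lattice_size_min and naive_lattice_size_min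
   below. *)
Definition lattice_size (R : realType) (P : set 'cV[R]_2) : R :=
  inf (lattice_size_set P).

Definition naive_lattice_size (R : realType) (Q : set 'cV[R]_2) : R :=
  inf (naive_lattice_size_set Q).

Definition is_min (R : realType) (E : set R) (m : R) : Prop :=
  E m /\ lbound E m.

Lemma is_min_inf (R : realType) (E : set R) (m : R) : is_min E m -> inf E = m.
Proof.
case=> Em mE; apply/eqP; rewrite eq_le; apply/andP; split.
  by apply: ge_inf => //; exists m.
by apply: lb_le_inf => //; exists m.
Qed.

Lemma std_simplexE (R : realType) :
  @std_simplex R = [set x | [/\ 0 <= x 0 0, 0 <= x 1 0 & x 0 0 + x 1 0 <= 1]].
Proof.
apply/seteqP; split=> [|x [x0 x1 x01]].
  apply: smallest_sub; last first.
    by move=> x [[->|->]|->]; split; rewrite !mxE ?addr0 ?add0r //= ?ler01.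
  move=> x y k /[!inE] -[x0 x1 x01] [y0 y1 y01].
  have k0 : 0 <= k%:num by [].
  have k1 : 0 <= 1 - k%:num by rewrite subr_ge0.
  have -> : conv k x y = k%:num *: (x : 'cV[R]_2) + (1 - k%:num) *: (y : 'cV[R]_2) by [].
  rewrite /=; split; rewrite !mxE; [nra|nra|].
  nra.
move=> C /= [cC sC].
have C0 : C 0 by apply: sC; left; left.
have Ce0 : C (delta_mx 0 0) by apply: sC; left; right.
have Ce1 : C (delta_mx 1 0) by apply: sC; right.
have cv (a b : 'cV[R]_2) (k : R) : 0 <= k -> k <= 1 -> C a -> C b ->
    C (k *: a + (1 - k) *: b).
  move=> k0 k1 Ca Cb; have := cC a b (Itv01 k0 k1).
  by rewrite !inE => /(_ Ca Cb).
set s := x 0 0 + x 1 0.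
have [s0|s0] := eqVneq s 0.
  have -> : x = 0; last exact: C0.
    apply/colP => i; rewrite mxE.
    have [x00 x10] : x 0 0 = 0 /\ x 1 0 = 0 by split; rewrite /s in s0; lra.
    by case: i => -[|[|//]] hi; [rewrite -[RHS]x00|rewrite -[RHS]x10];
      congr (x _ _); apply: val_inj.
have sp : 0 < s by rewrite lt_def s0 /s addr_ge0.
have := cv _ 0 s (ltW sp) x01 (cv _ _ (x 0 0 / s) _ _ Ce0 Ce1) C0.
have -> : s *: (x 0 0 / s *: delta_mx 0 0 + (1 - x 0 0 / s) *: delta_mx 1 0)
     + (1 - s) *: 0 = x.
  apply/colP => i; rewrite !mxE mulr0 addr0.
  case: i => -[|[|//]] hi /=.
    by rewrite mulr1 mulr0 addr0 mulrCA divff // mulr1; congr (x _ _); apply: val_inj.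
  rewrite mulr1 mulr0 add0r mulrBr mulrCA divff // !mulr1 /s addrAC subrr add0r.
  by congr (x _ _); apply: val_inj.
apply; first by rewrite divr_ge0 // ltW.
by rewrite ler_pdivrMr // mul1r /s lerDl.
Qed.

Lemma dilate_simplexE (R : realType) (l : R) : 0 <= l ->
  dilate l (@std_simplex R) =
  [set x | [/\ 0 <= x 0 0, 0 <= x 1 0 & x 0 0 + x 1 0 <= l]].
Proof.
move=> l0; rewrite std_simplexE; apply/seteqP; split=> [_ [x [x0 x1 x01] <-]|x].
  by rewrite /= !mxE; split; nra.
move=> [x0 x1 x01]; have [le0|ln0] := eqVneq l 0.
  exists 0; first by rewrite /= !mxE addr0.
  rewrite scaler0; apply/esym/colP => i; rewrite mxE.
  have [x00 x10] : x 0 0 = 0 /\ x 1 0 = 0 by split; lra.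
  by case: i => -[|[|//]] hi; [rewrite -[RHS]x00|rewrite -[RHS]x10];
    congr (x _ _); apply: val_inj.
exists (l^-1 *: x); last by rewrite scalerA divff // scale1r.
have lp : 0 < l by rewrite lt_def ln0.
rewrite /= !mxE; split; [by rewrite mulr_ge0 // invr_ge0|by rewrite mulr_ge0 // invr_ge0|].
by rewrite -mulrDr mulrC ler_pdivrMr // mul1r.
Qed.

Definition fits (R : realType) (l : R) (Q : set 'cV[R]_2) : Prop :=
  exists v : 'cV[R]_2, translate v Q `<=` dilate l (@std_simplex R).

Lemma fitsP (R : realType) (l : R) (Q : set 'cV[R]_2) : 0 <= l ->
  fits l Q <-> exists a b : R, forall x, Q x ->
    [/\ a <= x 0 0, b <= x 1 0 & x 0 0 + x 1 0 <= l + a + b].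
Proof.
move=> l0; rewrite /fits dilate_simplexE //; split=> [[v vQ]|[a [b ab]]].
  exists (- v 0 0), (- v 1 0) => x Qx.
  have /= := vQ (x + v); rewrite !mxE => -[|h1 h2 h3]; first by exists x.
  by split; lra.
exists (\col_i if i == 0 then - a else - b) => _ [x Qx <-].
have [h1 h2 h3] := ab _ Qx.
by rewrite /= !mxE /=; split; lra.
Qed.

Lemma fits_width (R : realType) (l : R) (Q : set 'cV[R]_2) x y i : 0 <= l ->
  fits l Q -> Q x -> Q y -> x i 0 - y i 0 <= l.
Proof.
move=> l0 /(fitsP _ l0)[a [b ab]] Qx Qy.
have [x0 x1 x2] := ab _ Qx; have [y0 y1 y2] := ab _ Qy.
case: i => -[|[|//]] hi.
  have -> : Ordinal hi = 0 by apply: val_inj.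
  lra.
have -> : Ordinal hi = 1 by apply: val_inj.
lra.
Qed.

(* The least l such that some translate of Q lies in the l-dilate of the
   standard simplex. *)
Definition fit_size (R : realType) (Q : set 'cV[R]_2) : R :=
  sup [set x 0 0 + x 1 0 | x in Q] - inf [set x 0 0 | x in Q]
    - inf [set x 1 0 | x in Q].

Definition cbounded (R : realType) (Q : set 'cV[R]_2) : Prop :=
  exists M : R, forall x i, Q x -> `|x i 0| <= M.

Lemma fits_size (R : realType) (Q : set 'cV[R]_2) : Q !=set0 -> cbounded Q ->
  0 <= fit_size Q /\ forall l, 0 <= l -> fits l Q <-> fit_size Q <= l.
Proof.
move=> [q Qq] [M QM].
have im0 (f : 'cV[R]_2 -> R) : [set f x | x in Q] !=set0 by exists (f q), q.
have lo i : has_lbound [set (x : 'cV[R]_2) i 0 | x in Q].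
  by exists (- M) => _ [x Qx <-]; have := QM x i Qx; rewrite ler_norml => /andP[].
have up : has_ubound [set (x : 'cV[R]_2) 0 0 + x 1 0 | x in Q].
  exists (M + M) => _ [x Qx <-].
  have := QM x 0 Qx; have := QM x 1 Qx; rewrite !ler_norml.
  by move=> /andP[_ h1] /andP[_ h2]; lra.
have hx0 x : Q x -> inf [set (x : 'cV[R]_2) 0 0 | x in Q] <= x 0 0.
  by move=> Qx; apply: ge_inf => //; exists x.
have hx1 x : Q x -> inf [set (x : 'cV[R]_2) 1 0 | x in Q] <= x 1 0.
  by move=> Qx; apply: ge_inf => //; exists x.
have hx2 x : Q x -> x 0 0 + x 1 0 <= sup [set (x : 'cV[R]_2) 0 0 + x 1 0 | x in Q].
  by move=> Qx; apply: ub_le_sup => //; exists x.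
split; first by rewrite /fit_size; have := hx0 _ Qq; have := hx1 _ Qq; have := hx2 _ Qq; lra.
move=> l l0; rewrite fitsP // /fit_size; split=> [[a [b ab]]|h].
  have h0 : a <= inf [set (x : 'cV[R]_2) 0 0 | x in Q].
    by apply: lb_le_inf => // _ [x Qx <-]; have [] := ab x Qx.
  have h1 : b <= inf [set (x : 'cV[R]_2) 1 0 | x in Q].
    by apply: lb_le_inf => // _ [x Qx <-]; have [] := ab x Qx.
  have h2 : sup [set (x : 'cV[R]_2) 0 0 + x 1 0 | x in Q] <= l + a + b.
    by apply: ge_sup => // _ [x Qx <-]; have [] := ab x Qx.
  lra.
eexists; eexists => x Qx; split; [exact: hx0|exact: hx1|].
have := hx2 x Qx; lra.
Qed.

Lemma argmin_finite (T : choiceType) (R : realType) (A : set T) (f : T -> R) :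
  A !=set0 -> (forall c, finite_set [set x | A x /\ f x <= c]) ->
  exists2 x, A x & forall y, A y -> f x <= f y.
Proof.
move=> [x0 Ax0] /(_ (f x0)) /finite_seqP[s As].
have [z zs zmin] : exists2 z, z \in s & forall y, y \in s -> f z <= f y.
  have : x0 \in s by have : [set` s] x0 by rewrite -As /=.
  elim: s x0 {Ax0 As} => // a s IH x0 _.
  case: s IH => [_|b s IH]; first by exists a; rewrite ?mem_head // => y; rewrite inE => /eqP ->.
  have [z zs zmin] := IH b (mem_head _ _).
  have [az|/ltW za] := leP (f a) (f z).
    exists a; first exact: mem_head.
    by move=> y; rewrite inE => /predU1P[->//|/zmin]; exact: le_trans.
  exists z; first by rewrite inE zs orbT.
  by move=> y; rewrite inE => /predU1P[->//|/zmin].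
have [Az zx0] : [set x | A x /\ f x <= f x0] z by rewrite As.
exists z => // y Ay; have [yx0|/ltW x0y] := leP (f y) (f x0); last exact: le_trans zx0 x0y.
by apply: zmin; have : [set` s] y by rewrite -As.
Qed.

Lemma min_family (T : choiceType) (R : realType) (A : set T)
    (Q : T -> set 'cV[R]_2) :
  A !=set0 -> (forall t, Q t !=set0) -> (forall t, cbounded (Q t)) ->
  (forall l, 0 <= l -> finite_set [set t | A t /\ fits l (Q t)]) ->
  exists m, is_min [set l | 0 <= l /\ exists2 t, A t & fits l (Q t)] m.
Proof.
move=> A0 Q0 Qb fin.
have [t At tmin] : exists2 t, A t &
    forall u, A u -> fit_size (Q t) <= fit_size (Q u).
  apply: argmin_finite => // c.
  have [c0|c0] := leP 0 c.
    apply: sub_finite_set (fin c c0) => t /= [At ht]; split=> //.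
    by have [_ ->] := fits_size (Q0 t) (Qb t).
  rewrite (_ : [set x | _] = set0) // -subset0 => t [At tc].
  by have [+ _] := fits_size (Q0 t) (Qb t); lra.
have [t0 tE] := fits_size (Q0 t) (Qb t).
exists (fit_size (Q t)); split.
  by split=> //; exists t => //; apply/tE.
move=> l [l0 [u Au fu]].
have [_ uE] := fits_size (Q0 u) (Qb u).
by apply: le_trans (tmin u Au) _; apply/uE.
Qed.

Lemma mx_image_bounded (R : realType) (A : 'M[R]_2) (Q : set 'cV[R]_2) :
  cbounded Q -> cbounded (mx_image A Q).
Proof.
move=> [M QM]; exists (\sum_i \sum_j `|A i j| * M) => _ i [x Qx <-].
have M0 : 0 <= M by exact: le_trans (normr_ge0 _) (QM x 0 Qx).
apply: (@le_trans _ _ (\sum_j `|A i j| * M)); last first.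
  rewrite [leRHS](bigD1 i) //= lerDl.
  by apply: sumr_ge0 => k _; apply: sumr_ge0 => j _; rewrite mulr_ge0.
rewrite mxE; apply: le_trans (ler_norm_sum _ _ _) _.
by apply: ler_sum => j _; rewrite normrM ler_wpM2l // QM.
Qed.

Lemma compact_cbounded (R : realType) (P : set 'cV[R]_2) :
  compact P -> cbounded P.
Proof.
move=> /compact_bounded[M [_ hM]]; exists (M + 1) => x i Px.
have := hM (M + 1); rewrite ltrDl ltr01 => /(_ isT x Px).
by apply: le_trans; rewrite /Num.norm /= mx_normrE; apply: (le_bigmax _ _ (i, 0)).
Qed.

Lemma naive_lattice_size_min (R : realType) (Q : set 'cV[R]_2) :
  Q !=set0 -> compact Q ->
  is_min (naive_lattice_size_set Q) (naive_lattice_size Q).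
Proof.
move=> [q Qq] /compact_cbounded bQ.
have [||||m mmin] := @min_family _ R (@sign_diag R) (fun D : 'M[R]_2 => mx_image D Q).
- exists 1%:M; split; first exact: scalar_mx_is_diag.
  by move=> i; rewrite mxE eqxx; left.
- by move=> D; exists (D *m q), q.
- by move=> D; exact: mx_image_bounded.
- move=> l _.
  pose g (f : {ffun 'I_2 -> bool}) : 'M[R]_2 := diag_mx (\row_i (-1) ^+ f i).
  apply: (@sub_finite_set _ _ (g @` setT)); last exact/finite_image/finite_finset.
  move=> D [[/is_diag_mxP Dd Dpm] _].
  exists [ffun i => D i i != 1] => //; apply/matrixP => i j.
  rewrite !mxE ffunE; have [<-|ij] := eqVneq i j; last by rewrite mulr0n Dd.
  rewrite mulr1n; case: (Dpm i) => ->; first by rewrite eqxx expr0.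
  have -> : (-1 != 1 :> R) by apply/eqP => h; lra.
  by rewrite expr1.
have E : naive_lattice_size_set Q =
    [set l | 0 <= l /\ exists2 D, sign_diag D & fits l (mx_image D Q)].
  apply/seteqP; split=> l [l0].
    by move=> [D [v [Ds h]]]; split=> //; exists D => //; exists v.
  by move=> [D Ds [v h]]; split=> //; exists D, v.
by rewrite /naive_lattice_size E (is_min_inf mmin).
Qed.

Lemma interior_segment (R : realType) (P : set 'cV[R]_2) : P° !=set0 ->
  exists p (r : R), [/\ 0 < r, P p & forall j, P (p + r *: delta_mx j 0)].
Proof.
move=> [p]; rewrite /interior /= => /nbhs_ballP[e /= e0 he].
have hp : P p by apply: he; exact: ballxx.
exists p, (e / 2); split => //; first by rewrite divr_gt0.
move=> j; apply: he; split=> // i k; rewrite /ball /= !mxE opprD addrA subrr sub0r normrN.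
rewrite normrM (gtr0_norm (divr_gt0 e0 _)) //.
by case: (_ && _); rewrite ?normr1 ?normr0 ?mulr1 ?mulr0 //; lra.
Qed.

Lemma finite_int_mx (M : nat) :
  finite_set [set B : 'M[int]_2 | forall i j, `|B i j| <= M%:Z].
Proof.
pose g (C : 'M['I_(M + M).+1]_2) : 'M[int]_2 :=
  \matrix_(i, j) ((C i j : nat)%:Z - M%:Z).
apply: (@sub_finite_set _ _ (g @` setT)); last exact/finite_image/finite_finset.
move=> B hB; exists (\matrix_(i, j) inord (absz (B i j + M%:Z))) => //.
apply/matrixP => i j; rewrite !mxE; have := hB i j; move: (B i j) => b hb.
by rewrite inordK; lia.
Qed.

Lemma lattice_size_min (R : realType) (P : set 'cV[R]_2) :
  convex_body P -> is_min (lattice_size_set P) (lattice_size P).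
Proof.
move=> [/compact_cbounded bP _ /interior_segment[p [r [r0 Pp Pr]]]].
have [||||m mmin] := @min_family _ R GL2Z
  (fun B => mx_image (map_mx intr B) P).
- by exists 1%:M; left; rewrite det1.
- by move=> B; exists (map_mx intr B *m p), p.
- by move=> B; exact: mx_image_bounded.
- move=> l l0.
  apply: sub_finite_set (finite_int_mx (Num.bound (l / r))) => B [_ fB] i j.
  have key : `|(B i j)%:~R| * r <= l.
    have h x y : P x -> P y ->
        (map_mx intr B *m x) i 0 - (map_mx intr B *m y) i 0 <= l.
      by move=> Px Py; apply: fits_width fB _ _ => //; [exists x|exists y].
    have e : (map_mx intr B *m (p + r *: delta_mx j 0)) i 0 =
        (map_mx intr B *m p) i 0 + r * (B i j)%:~R.
      by rewrite mulmxDr -scalemxAr -colE !mxE.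
    have := h _ _ (Pr j) Pp; have := h _ _ Pp (Pr j); rewrite e.
    have <- : `|(B i j)%:~R * r| = `|(B i j)%:~R| * r :> R.
      by rewrite normrM (gtr0_norm r0).
    by rewrite ler_norml; lra.
  rewrite -(ler_int R) intr_norm; apply: (@le_trans _ _ (l / r)).
    by rewrite ler_pdivlMr.
  by apply/ltW/archi_boundP/divr_ge0 => //; exact: ltW.
have E : lattice_size_set P =
    [set l | 0 <= l /\ exists2 B, GL2Z B & fits l (mx_image (map_mx intr B) P)].
  apply/seteqP; split=> l [l0].
    by move=> [B [v [Bs h]]]; split=> //; exists B => //; exists v.
  by move=> [B Bs [v h]]; split=> //; exists B, v.
by rewrite /lattice_size E (is_min_inf mmin).
Qed.

(* Main.v *)
Require Import Defs.
From mathcomp Require Import all_boot all_order all_algebra.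
From mathcomp Require Import all_classical all_reals all_analysis.
From mathcomp Require Import lra zify.
Import Order.TTheory GRing.Theory Num.Theory.
Import numFieldNormedType.Exports.

(** Let s be the support function of P, w u = s u + s (- u) its width, and
    T u v = s u + s v + s (- (u + v)).  The smallest dilate of the standard
    simplex into which a unimodular image B P can be translated has size
    T (- b1) (- b2), where b1 and b2 are the rows of B, so the lattice size is
    the minimum of T over all bases of the lattice, and the naive lattice size
    of A P is its minimum over the four bases (+- h1, +- h2).

    T depends only on the triple u, v, - (u + v), of which any two vectors form
    a basis.  Writing the vectors in the coordinates given by (h1, h2), some two
    vectors of the triple lie in one closed quadrant
    ([superbase_same_quadrant]), and every basis of Z^2 contained in a closed
    quadrant is obtained from the two unit vectors spanning that quadrant by
    repeatedly replacing (u, v) by (u, u + v) or (u + v, v): this is the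
    Stern-Brocot tree ([stern_brocot_ind]).

    Replacing (u, v) by (u, u + v) does not decrease T as long as
    w v <= w (u + v) ([superbase_sum_step]), and convexity of w carries the inequalities
    w u, w v <= w (u + v) to the next pair ([width_of_step]).  At the root of
    the tree of each quadrant they are exactly the hypothesis that (h1, h2) is
    reduced.  Hence T of any basis is at least T of one of the (+- h1, +- h2),
    so that a dilate of the simplex receiving some unimodular image of P also
    receives one of the four images of A P: the two sets of admissible l are
    equal. *)

Set Implicit Arguments.
Unset Strict Implicit.

Local Open Scope classical_set_scope.
Local Open Scope ring_scope.

(** * Unimodular pairs of integer vectors *)

(** Subtractive Euclidean algorithm: a pair of determinant +-1 with natural
    coordinates is either one of the two orderings of (p, r), or one of its
    vectors dominates the other coordinatewise and can be replaced by the
    difference. *)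
Lemma stern_brocot_ind (V : zmodType) (K : V -> V -> Prop) (p r : V) :
  K p r -> (forall u v, K u v -> K v u) -> (forall u v, K u v -> K u (u + v)) ->
  forall a b c d : nat,
    (a * d = (b * c).+1)%N \/ (b * c = (a * d).+1)%N ->
    K (p *+ a + r *+ b) (p *+ c + r *+ d).
Proof.
move=> Kpr KC KD a b c d; have [n] := ubnP (a + b + c + d)%N.
elim: n a b c d => // n IH a b c d lt_n det1.
have step a' b' c' d' : (a' + b' + c' + d' < n.+1)%N ->
    (a' * d' = (b' * c').+1)%N \/ (b' * c' = (a' * d').+1)%N ->
    (a' <= c')%N -> (b' <= d')%N ->
    K (p *+ a' + r *+ b') (p *+ c' + r *+ d').
  move=> lt_n' det1' ac bd.
  (* The smaller vector is nonzero, so the total of the coordinates drops. *)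
  rewrite -(subnKC ac) -(subnKC bd) !mulrnDr addrACA.
  apply/KD/IH; last by nia.
  have : (0 < a' + b')%N by nia.
  by lia.
have [/andP[ac bd]|nle] := boolP ((a <= c) && (b <= d))%N; first exact: step.
have [/andP[ca db]|nge] := boolP ((c <= a) && (d <= b))%N.
  by apply/KC/step => //; [lia|lia].
(* With no domination the determinant is too large, unless the two vectors are
   the unit vectors. *)
have [[ca bd]|[ac db]] : (c < a /\ b < d)%N \/ (a < c /\ d < b)%N by lia.
  have [-> -> -> ->] : [/\ a = 1, b = 0, c = 0 & d = 1]%N by split; nia.
  by rewrite !mulr0n !mulr1n add0r addr0.
have [-> -> -> ->] : [/\ a = 0, b = 1, c = 1 & d = 0]%N by split; nia.
by rewrite !mulr0n !mulr1n add0r addr0; apply: KC.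
Qed.

(** Closed quadrants overlap along the axes, so the vectors do not determine the
    signs e and f of the quadrant. *)
Definition same_quadrant (a b c d : int) : Prop :=
  exists e f : bool, [/\ 0 <= (-1) ^+ e * a, 0 <= (-1) ^+ f * b,
    0 <= (-1) ^+ e * c & 0 <= (-1) ^+ f * d].

Lemma same_quadrantP (a b c d : int) :
  0 <= a * c -> 0 <= b * d -> same_quadrant a b c d.
Proof.
move=> ac bd; exists ((a < 0) || (c < 0)), ((b < 0) || (d < 0)).
by split; case: orP => h /=; rewrite ?expr0 ?expr1; nia.
Qed.

Lemma mulz_eq_pm1 (x y : int) : x * y = 1 \/ x * y = -1 -> y = 1 \/ y = -1.
Proof.
have u (z t : int) : z * t = 1 -> t = 1 \/ t = -1.
  by move=> /intUnitRing.unitzPl; rewrite qualifE /= => /orP[]/eqP; [left|right].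
case=> [/u//|xy]; apply: (u (- x)); lia.
Qed.

Lemma same_quadrant_swap (a b c d : int) :
  same_quadrant a b c d -> same_quadrant b a d c.
Proof. by case=> e [f [? ? ? ?]]; exists f, e. Qed.

(** Two vectors in a common half-plane but strictly on opposite sides of the
    other axis: the products a d and b c have opposite signs, so one of
    them vanishes and the other is +-1, which puts one of the vectors on
    an axis, at a unit vector. *)
Lemma superbase_mixed_sign (a b c d : int) :
  a * d - b * c = 1 \/ a * d - b * c = -1 -> 0 <= a * c -> b * d < 0 ->
  same_quadrant a b (- (a + c)) (- (b + d)) \/
  same_quadrant c d (- (a + c)) (- (b + d)).
Proof.
move=> det1 ac bd.
have [a0|c0] : a = 0 \/ c = 0 by nia.
  left; subst a.
  have [b1|b1] : b = 1 \/ b = -1 by apply: (@mulz_eq_pm1 c); lia.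
    by subst b; apply: same_quadrantP; lia.
  by subst b; apply: same_quadrantP; lia.
right; subst c.
have [d1|d1] : d = 1 \/ d = -1 by apply: (@mulz_eq_pm1 a); lia.
  by subst d; apply: same_quadrantP; lia.
by subst d; apply: same_quadrantP; lia.
Qed.

(** When (a, b) and (c, d) lie in opposite open quadrants, the sum of the triple
    being zero forces the third vector opposite to the larger of them, hence in
    the quadrant of the smaller one; the determinant rules out that neither is
    the larger in both coordinates. *)
Lemma superbase_same_quadrant (a b c d : int) :
  a * d - b * c = 1 \/ a * d - b * c = -1 ->
  [\/ same_quadrant a b c d, same_quadrant a b (- (a + c)) (- (b + d))
    | same_quadrant c d (- (a + c)) (- (b + d))].
Proof.
move=> det1.
have [ac|ac] := leP 0 (a * c); have [bd|bd] := leP 0 (b * d).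
- by apply: Or31; apply: same_quadrantP.
- by have [] := superbase_mixed_sign det1 ac bd; [apply: Or32|apply: Or33].
- have det1' : b * c - a * d = 1 \/ b * c - a * d = -1 by lia.
  by have [/same_quadrant_swap|/same_quadrant_swap] :=
    superbase_mixed_sign det1' bd ac; [apply: Or32|apply: Or33].
(* Both products have the same sign, so the determinant condition also holds
   for the absolute values. *)
have ad : 0 < (a * d) * (b * c) by nia.
have det1' : `|a| * `|d| - `|b| * `|c| = 1 \/ `|a| * `|d| - `|b| * `|c| = -1.
  by rewrite -!normrM; lia.
have [[ca db]|nge] := EM (`|c| <= `|a| /\ `|d| <= `|b|).
  by apply: Or33; apply: same_quadrantP; nia.
have [[lac lbd]|nle] := EM (`|a| <= `|c| /\ `|b| <= `|d|).
  by apply: Or32; apply: same_quadrantP; nia.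
have [[ca bd']|[ac' db]] :
    `|c| + 1 <= `|a| /\ `|b| + 1 <= `|d| \/ `|a| + 1 <= `|c| /\ `|d| + 1 <= `|b|.
  lia.
- nia.
- nia.
Qed.

(** * Sublinear functions on the bases of a lattice *)

Definition sublinear (R : realType) (V : lmodType R) (s : V -> R) : Prop :=
  (forall u v, s (u + v) <= s u + s v) /\
  (forall k u, 0 < k -> s (k *: u) = k * s u).

Definition width_of (R : realType) (V : lmodType R) (s : V -> R) (u : V) : R :=
  s u + s (- u).

(** When s is the support function of a body and u, v are independent, this is
    the factor by which the triangle u.x <= 0, v.x <= 0, - (u + v).x <= 1 has to
    be dilated to contain a translate of the body. *)
Definition superbase_sum (R : realType) (V : lmodType R) (s : V -> R)
    (u v : V) : R :=
  s u + s v + s (- (u + v)).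

Lemma superbase_sumC (R : realType) (V : lmodType R) (s : V -> R) (u v : V) :
  superbase_sum s u v = superbase_sum s v u.
Proof. by rewrite /superbase_sum [s u + _]addrC [u + v]addrC. Qed.

Lemma superbase_sum_third (R : realType) (V : lmodType R) (s : V -> R)
    (u v : V) :
  superbase_sum s u (- (u + v)) = superbase_sum s u v.
Proof.
by rewrite /superbase_sum opprB (addrC u v) addrK addrAC.
Qed.

Lemma width_ofN (R : realType) (V : lmodType R) (s : V -> R) (u : V) :
  width_of s (- u) = width_of s u.
Proof. by rewrite /width_of opprK addrC. Qed.

(** Writing q = u + v, the difference of the two sides is
    s q + s (- q - u) - s (- q) - s v.  Since s q + s (- q) >= s v + s (- v), it
    is at least s (- v) + s (- q - u) - 2 s (- q), and this is nonnegative by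
    sublinearity because (- v) + (- q - u) = 2 (- q). *)
Lemma superbase_sum_step (R : realType) (V : lmodType R) (s : V -> R)
    (u v : V) :
  sublinear s -> width_of s v <= width_of s (u + v) ->
  superbase_sum s u v <= superbase_sum s u (u + v).
Proof.
move=> [sD sZ]; rewrite /width_of /superbase_sum => wv.
have := sD (- v) (- (u + (u + v))).
have -> : - v - (u + (u + v)) = 2 *: - (u + v).
  by rewrite scaler_nat mulr2n -!opprD [v + _]addrA [v + u]addrC.
by rewrite sZ //; lra.
Qed.

(** Convexity of the width along the arithmetic progression v, u + v,
    u + (u + v): if it does not decrease at the
    first step, it does not at the second. *)
Lemma width_of_step (R : realType) (V : lmodType R) (s : V -> R) (u v : V) :
  sublinear s -> width_of s v <= width_of s (u + v) ->
  width_of s (u + v) <= width_of s (u + (u + v)).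
Proof.
move=> [sD sZ]; rewrite /width_of => wv.
have := sD v (u + (u + v)); have := sD (- v) (- (u + (u + v))).
have <- : 2 *: (u + v) = v + (u + (u + v)).
  by rewrite scaler_nat mulr2n [RHS]addrA [v + u]addrC.
rewrite -opprD.
have <- : 2 *: (u + v) = v + (u + (u + v)).
  by rewrite scaler_nat mulr2n [RHS]addrA [v + u]addrC.
by rewrite -scalerN !sZ //; lra.
Qed.

(** The width inequalities are part of what is propagated along the
    Stern-Brocot tree, since the step on [superbase_sum] relies on them. *)
Lemma superbase_sum_quadrant (R : realType) (V : lmodType R) (s : V -> R)
    (p r : V) (a b c d : nat) :
  sublinear s ->
  width_of s p <= width_of s (p + r) -> width_of s r <= width_of s (p + r) ->
  (a * d = (b * c).+1)%N \/ (b * c = (a * d).+1)%N ->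
  superbase_sum s p r <= superbase_sum s (p *+ a + r *+ b) (p *+ c + r *+ d).
Proof.
move=> hs wp wr det1.
pose K u v := [/\ width_of s u <= width_of s (u + v),
  width_of s v <= width_of s (u + v)
  & superbase_sum s p r <= superbase_sum s u v].
suff [] : K (p *+ a + r *+ b) (p *+ c + r *+ d) by [].
apply: stern_brocot_ind => // [u v [wu wv Tuv]|u v [wu wv Tuv]].
  by split; rewrite 1?[v + u]addrC // [leRHS]superbase_sumC.
have wuv := width_of_step hs wv.
split=> //; first exact: le_trans wu wuv.
exact: le_trans Tuv (superbase_sum_step hs wv).
Qed.

(** Two of the three vectors u, v, - (u + v) of the right-hand side lie in one
    quadrant, whose signs are e and f; replacing (u, v) by those two does not
    change [superbase_sum], and the result within a quadrant applies. *)
Lemma superbase_sum_min (R : realType) (V : lmodType R) (s : V -> R)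
    (p r : V) (a b c d : int) :
  sublinear s ->
  width_of s p <= width_of s (p + r) -> width_of s p <= width_of s (p - r) ->
  width_of s r <= width_of s (p + r) -> width_of s r <= width_of s (p - r) ->
  a * d - b * c = 1 \/ a * d - b * c = -1 ->
  exists e f : bool,
    superbase_sum s ((-1) ^+ e *: p) ((-1) ^+ f *: r) <=
    superbase_sum s (p *~ a + r *~ b) (p *~ c + r *~ d).
Proof.
move=> hs wp wp' wr wr' det1.
have wsign (e : bool) u : width_of s ((-1) ^+ e *: u) = width_of s u.
  by rewrite scaler_sign; case: e; rewrite ?width_ofN.
have sgn (e f : bool) :
    width_of s p <= width_of s ((-1) ^+ e *: p + (-1) ^+ f *: r)
    /\ width_of s r <= width_of s ((-1) ^+ e *: p + (-1) ^+ f *: r).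
  rewrite !scaler_sign; case: e; case: f => //.
    by rewrite -opprD width_ofN.
  have -> : - p + r = - (p - r) by rewrite opprB addrC.
  by rewrite width_ofN.
have quad x y z t : same_quadrant x y z t ->
    x * t - y * z = 1 \/ x * t - y * z = -1 ->
    exists e f : bool, superbase_sum s ((-1) ^+ e *: p) ((-1) ^+ f *: r) <=
      superbase_sum s (p *~ x + r *~ y) (p *~ z + r *~ t).
  move=> [e [f [x0 y0 z0 t0]]] xt; exists e, f.
  (* In the basis (+- p, +- r) of the quadrant the coordinates are natural. *)
  have abs (g : bool) (n : int) (v : V) : 0 <= (-1) ^+ g * n ->
      v *~ n = ((-1) ^+ g *: v) *+ absz ((-1) ^+ g * n).
    move=> n0; rewrite -scaler_nat scalerA -[n in LHS](signrMK g).
    by rewrite -{1}(gez0_abs n0) -scaler_int intrM rmorph_sign mulrC.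
  rewrite (abs e x) // (abs f y) // (abs e z) // (abs f t) //.
  have [wp1 wr1] := sgn e f.
  apply: superbase_sum_quadrant; rewrite ?wsign //.
  have := gez0_abs x0; have := gez0_abs y0; have := gez0_abs z0; have := gez0_abs t0.
  move: x0 y0 z0 t0.
  by case: e {sgn wp1 wr1}; case: f; rewrite ?expr0 ?expr1 ?mul1r ?mulN1r; nia.
have third : - (p *~ a + r *~ b + (p *~ c + r *~ d)) =
    p *~ (- (a + c)) + r *~ (- (b + d)).
  by rewrite !mulrNz !mulrzDr -opprD addrACA.
case: (superbase_same_quadrant det1) => /quad.
- exact.
- by rewrite -third superbase_sum_third; apply; lia.
- rewrite -third [_ *~ a + _ + _]addrC superbase_sum_third superbase_sumC.
  by apply; lia.
Qed.

(** * Support functions of bounded sets *)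

Definition support (R : realType) (P : set 'cV[R]_2) (h : 'rV[R]_2) : R :=
  sup [set (h *m x) 0 0 | x in P].

Lemma bounded_linear_image (R : realType) (P : set 'cV[R]_2) (h : 'rV[R]_2) :
  cbounded P -> has_ubound [set (h *m x) 0 0 | x in P].
Proof.
move=> [M PM]; exists (\sum_j `|h 0 j| * M) => _ [x Px <-].
rewrite mxE; apply: le_trans (ler_norm _) _; apply: le_trans (ler_norm_sum _ _ _) _.
by apply: ler_sum => j _; rewrite normrM ler_wpM2l // PM.
Qed.

Lemma le_support (R : realType) (P : set 'cV[R]_2) (h : 'rV[R]_2) x :
  cbounded P -> P x -> (h *m x) 0 0 <= support P h.
Proof.
by move=> bP Px; apply: ub_le_sup; [exact: bounded_linear_image|exists x].
Qed.

Lemma support_le (R : realType) (P : set 'cV[R]_2) (h : 'rV[R]_2) (m : R) :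
  P !=set0 -> (forall x, P x -> (h *m x) 0 0 <= m) -> support P h <= m.
Proof.
move=> [q Pq] hm; apply: ge_sup; first by exists ((h *m q) 0 0), q.
by move=> _ [x Px <-]; exact: hm.
Qed.

Lemma support_sublinear (R : realType) (P : set 'cV[R]_2) :
  P !=set0 -> cbounded P -> sublinear (support P).
Proof.
move=> P0 bP; split=> [u v|k u k0].
  apply: support_le => // x Px.
  by rewrite mulmxDl mxE lerD // le_support.
apply/eqP; rewrite eq_le; apply/andP; split.
  apply: support_le => // x Px.
  by rewrite -scalemxAl mxE ler_pM2l // le_support.
rewrite mulrC -ler_pdivlMr //; apply: support_le => // x Px.
have := le_support (k *: u) bP Px.
by rewrite -scalemxAl mxE ler_pdivlMr // mulrC.
Qed.

Lemma inf_linear_image (R : realType) (P : set 'cV[R]_2) (h : 'rV[R]_2) :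
  inf [set (h *m x) 0 0 | x in P] = - support P (- h).
Proof.
rewrite /inf /support image_comp; congr (- sup _).
by apply: eq_imagel => x _ /=; rewrite mulNmx [RHS]mxE.
Qed.

Lemma lattice_width_support (R : realType) (P : set 'cV[R]_2) (h : 'rV[R]_2) :
  lattice_width P h = width_of (support P) h.
Proof. by rewrite /lattice_width inf_linear_image opprK. Qed.

(** The minima of the coordinates over M P are minus the values of the support
    function at the opposite rows, and the maximum of their sum is its value at
    the sum of the rows. *)
Lemma fit_size_image (R : realType) (M : 'M[R]_2) (P : set 'cV[R]_2) :
  fit_size (mx_image M P) = superbase_sum (support P) (- row 0 M) (- row 1 M).
Proof.
have rowE i x : (M *m x) i 0 = (row i M *m x) 0 0 by rewrite -row_mul [RHS]mxE.
have infE i : inf [set (y : 'cV[R]_2) i 0 | y in mx_image M P] =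
    - support P (- row i M).
  rewrite -inf_linear_image /mx_image image_comp; congr inf.
  by apply: eq_imagel => x _ /=; exact: rowE.
have supE : sup [set (y : 'cV[R]_2) 0 0 + y 1 0 | y in mx_image M P] =
    support P (row 0 M + row 1 M).
  rewrite /support /mx_image image_comp; congr sup.
  by apply: eq_imagel => x _ /=; rewrite !rowE mulmxDl [RHS]mxE.
rewrite /fit_size /superbase_sum !infE supE !opprK -opprD opprK.
by rewrite -addrA addrC.
Qed.

Lemma fits_image (R : realType) (M : 'M[R]_2) (P : set 'cV[R]_2) (l : R) :
  P !=set0 -> cbounded P -> 0 <= l ->
  fits l (mx_image M P) <->
  superbase_sum (support P) (- row 0 M) (- row 1 M) <= l.
Proof.
move=> [q Pq] bP l0; rewrite -fit_size_image.
have [|_ h] := fits_size (Q := mx_image M P) _ (mx_image_bounded M bP); last exact: h.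
by exists (M *m q), q.
Qed.

(** * Integer matrices and lattice bases *)

Lemma row_mul_col_mx (C : 'M[int]_2) (h1 h2 : 'rV[int]_2) (i : 'I_2) :
  row i (C *m col_mx h1 h2) = C i 0 *: h1 + C i 1 *: h2.
Proof.
have CE : C = row_mx (col 0 C) (col 1 C) :> 'M[int]_(2, 1 + 1).
  apply/matrixP => j k; rewrite mxE.
  by case: splitP => k' kE; rewrite mxE; congr (C _ _); apply: val_inj;
    rewrite /= kE (ord1 k').
have -> : C *m col_mx h1 h2 = col 0 C *m h1 + col 1 C *m h2.
  by rewrite [in LHS]CE; exact: (mul_row_col (col 0 C) (col 1 C)).
by apply/rowP => j; rewrite !mxE !big_ord1 !mxE.
Qed.

Lemma row_intr_mul_col_mx (R : realType) (C : 'M[int]_2)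
    (h1 h2 : 'rV[int]_2) (i : 'I_2) :
  row i (map_mx intr (C *m col_mx h1 h2)) =
    (map_mx intr h1 : 'rV[R]_2) *~ C i 0 + map_mx intr h2 *~ C i 1.
Proof.
rewrite -map_row row_mul_col_mx map_mxD !map_mxZ /=.
by rewrite !scaler_int.
Qed.

Lemma lattice_basis_factor (h1 h2 : 'rV[int]_2) (B : 'M[int]_2) :
  lattice_basis h1 h2 -> exists C : 'M[int]_2, B = C *m col_mx h1 h2.
Proof.
move=> hb.
have /choice[c hc] i : exists c : int * int, row i B = c.1 *: h1 + c.2 *: h2.
  by have [c [hc _]] := hb (row i B); exists c.
exists (\matrix_(i, j) if j == 0 then (c i).1 else (c i).2).
by apply/row_matrixP => i; rewrite hc row_mul_col_mx !mxE.
Qed.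

(** The coordinates of the standard basis in (h1, h2) give an integer inverse. *)
Lemma lattice_basis_det (h1 h2 : 'rV[int]_2) :
  lattice_basis h1 h2 -> GL2Z (col_mx h1 h2).
Proof.
move=> hb; have [C] := lattice_basis_factor 1%:M hb.
move=> /(congr1 determinant); rewrite det1 det_mulmx => /esym dC.
by apply: (@mulz_eq_pm1 (\det C)); left.
Qed.

Lemma GL2Z_mul (B C : 'M[int]_2) : GL2Z B -> GL2Z C -> GL2Z (B *m C).
Proof.
rewrite /GL2Z det_mulmx => -[->|->] -[->|->];
  by rewrite ?mul1r ?mulN1r ?opprK; by [left|right].
Qed.

Lemma det_mx2 (C : 'M[int]_2) : \det C = C 0 0 * C 1 1 - C 0 1 * C 1 0.
Proof.
rewrite (expand_det_row _ 0) big_ord_recl big_ord1 /cofactor !det_mx11 !mxE /=.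
rewrite expr0 expr1 mul1r mulN1r mulrN.
by congr (_ * C _ _ - C _ _ * C _ _); apply: val_inj.
Qed.

Definition sign_mx (e f : bool) : 'M[int]_2 :=
  diag_mx (\row_i (-1) ^+ (if i == 0 then e else f)).

Lemma GL2Z_sign_mx (e f : bool) : GL2Z (sign_mx e f).
Proof.
rewrite /GL2Z det_diag big_ord_recl big_ord1 !mxE /=.
by case: e; case: f; [left|right|right|left].
Qed.

Lemma sign_diagP (R : realType) (D : 'M[R]_2) :
  sign_diag D <-> exists e f, D = map_mx intr (sign_mx e f).
Proof.
split=> [[/is_diag_mxP Dd Dpm]|[e [f ->]]]; last first.
  split=> [|i]; first by rewrite map_diag_mx diag_mx_is_diag.
  rewrite !mxE eqxx mulr1n rmorph_sign.
  by case: (if _ then _ else _); [right|left].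
exists (D 0 0 != 1), (D 1 1 != 1); apply/matrixP => i j.
rewrite !mxE; have [<-|ij] := eqVneq i j; last by rewrite mulr0n Dd.
rewrite mulr1n rmorph_sign.
have sgn k : D k k = (-1) ^+ (D k k != 1).
  by case: (eqVneq (D k k) 1) (Dpm k) => [//|ne [h|//]]; rewrite h eqxx in ne.
case: i j => -[|[|//]] hi _; rewrite /=.
  by rewrite (_ : Ordinal hi = 0) //; apply: val_inj.
by rewrite (_ : Ordinal hi = 1) //; apply: val_inj.
Qed.

(** * Lattice size from a reduced basis *)

Unset Implicit Arguments.
Set Strict Implicit.

Theorem corollary2p8 (R : realType) (P : set 'cV[R]_2)
    (h1 h2 : 'rV[int]_2)
    (hP : convex_body P) (hred : reduced_basis P h1 h2) :
  let A : 'M[R]_2 := map_mx intr (col_mx h1 h2) in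
  lattice_size P = naive_lattice_size (mx_image A P).
Proof.
move=> A; have [/compact_cbounded bP _ [p /interior_subset Pp]] := hP.
have P0 : P !=set0 by exists p.
have [hb [w1 w1' w2 w2']] := hred.
have detA := lattice_basis_det hb.
have hs := support_sublinear P0 bP.
have signA (e f : bool) : mx_image (map_mx intr (sign_mx e f)) (mx_image A P) =
    mx_image (map_mx intr (sign_mx e f *m col_mx h1 h2)) P.
  rewrite map_mxM /mx_image image_comp.
  by apply: eq_imagel => x _ /=; rewrite mulmxA.
rewrite /lattice_size /naive_lattice_size; congr inf.
apply/seteqP; split=> l [l0].
- move=> [B [v [detB Bl]]]; split=> //.
  have [C BE] := lattice_basis_factor B hb.
  have detC : \det C = 1 \/ \det C = -1.
    move: detA detB; rewrite BE /GL2Z det_mulmx.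
    by move: (\det C) => k [->|->]; rewrite ?mulr1 ?mulrN1; lia.
  have /fits_image : fits l (mx_image (map_mx intr B) P) by exists v.
  move=> /(_ P0 bP l0).
  rewrite BE !row_intr_mul_col_mx !opprD -!mulrNz => Cl.
  have [|||||e [f ef]] := superbase_sum_min (p := map_mx intr h1)
    (r := map_mx intr h2) (a := - C 0 0) (b := - C 0 1) (c := - C 1 0)
    (d := - C 1 1) hs.
  + by rewrite -map_mxD -!lattice_width_support.
  + by rewrite -map_mxB -!lattice_width_support.
  + by rewrite -map_mxD -!lattice_width_support.
  + by rewrite -map_mxB -!lattice_width_support.
  + by rewrite !mulrNN -det_mx2.
  (* The normals are the opposites of the rows, hence the negated signs. *)
  have [v' Dl] : fits l
      (mx_image (map_mx intr (sign_mx (~~ e) (~~ f))) (mx_image A P)).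
    rewrite signA; apply/fits_image => //.
    apply: le_trans Cl; move: ef; congr (superbase_sum _ _ _ <= _);
      rewrite row_intr_mul_col_mx !mxE mulr1n mulr0n mulr0z ?addr0 ?add0r
        scaler_sign.
      by case: (e) => /=; rewrite ?expr0 ?expr1 ?mulrN1z ?mulr1z ?opprK.
    by case: (f) => /=; rewrite ?expr0 ?expr1 ?mulrN1z ?mulr1z ?opprK.
  exists (map_mx intr (sign_mx (~~ e) (~~ f))), v'; split=> //.
  by apply/sign_diagP; exists (~~ e), (~~ f).
- move=> [D [v [/sign_diagP[e [f ->]] Dl]]]; split=> //.
  exists (sign_mx e f *m col_mx h1 h2), v; split; last by rewrite -signA.
  exact: GL2Z_mul (GL2Z_sign_mx e f) detA.
Qed.
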